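(* Let $f:\mathbb{R}^{n_{\mathbf u}}\to\mathbb{R}$ be a convex differentiable function whose gradient is coordinate-wise Lipschitz continuous with constants $L_i>0$, $i=1,\dots,M$, i.e. $$\|\nabla_i f(\mathbf{u}+E^i h_i)-\nabla_i f(\mathbf{u})\|\le L_i\|h_i\|\qquad \forall\,\mathbf{u}\in\mathbb{R}^{n_{\mathbf u}},\ h_i\in\mathbb{R}^{n_{\mathbf u}^i},\ i=1,\dots,M.$$ Let $\mathbf{u}_*$ be an optimal solution and $f^*$ the optimal value of the problem $\min_{\mathbf{u}\in \mathbf{U}} f(\mathbf{u})$ with $\mathbf{U}=\mathbf{U}^1\times\cdots\times\mathbf{U}^M$, and let $(\mathbf{u}_k)_{k\ge 0}$ be the sequence generated by Algorithm PCDM from any $\mathbf{u}_0\in\mathbf{U}$. Then for all $k\ge 0$, $$f(\mathbf{u}_k)-f^*\le \frac{M}{M+k}\left(\frac12 r_0^2+f(\mathbf{u}_0)-f^*\right),$$ where $r_0=\|\mathbf{u}_0-\mathbf{u}_*\|_1$.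
   Context: Let $M\ge 1$, let $n_{\mathbf u}^1,\dots,n_{\mathbf u}^M$ be positive integers and $n_{\mathbf u}=\sum_{i=1}^M n_{\mathbf u}^i$. A vector $\mathbf{u}\in\mathbb{R}^{n_{\mathbf u}}$ is partitioned into blocks $\mathbf{u}=[(\mathbf{u}^1)^T\cdots(\mathbf{u}^M)^T]^T$ with $\mathbf{u}^i\in\mathbb{R}^{n_{\mathbf u}^i}$. The identity matrix is partitioned accordingly by columns as $I_{n_{\mathbf u}}=[E^1\ \cdots\ E^M]$ with $E^i\in\mathbb{R}^{n_{\mathbf u}\times n_{\mathbf u}^i}$, so $\mathbf{u}=\sum_i E^i\mathbf{u}^i$. The partial gradient is $\nabla_i f(\mathbf{u})=(E^i)^T\nabla f(\mathbf{u})\in\mathbb{R}^{n_{\mathbf u}^i}$. $\|\cdot\|$ and $\langle\cdot,\cdot\rangle$ denote the Euclidean norm and inner product. Given constants $L_i>0$, define the norm $\|\cdot\|_1$ on $\mathbb{R}^{n_{\mathbf u}}$ by $\|\mathbf{u}\|_1^2=\sum_{i=1}^M L_i\|\mathbf{u}^i\|^2$ (this is not the $\ell_1$-norm). The constraint sets $\mathbf{U}^i\subseteq\mathbb{R}^{n_{\mathbf u}^i}$ are nonempty, closed and convex, and the problem $\min_{\mathbf{u}\in\mathbf{U}} f(\mathbf{u})$ is assumed to have an optimal solution. Algorithm PCDM (Parallel Coordinate Descent Method): for $\mathbf{u}\in\mathbf{U}$ define $$\bar{\mathbf v}^i(\mathbf{u})=\arg\min_{\mathbf{v}^i\in\mathbf{U}^i}\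 \langle\nabla_i f(\mathbf{u}),\mathbf{v}^i-\mathbf{u}^i\rangle+\frac{L_i}{2}\|\mathbf{v}^i-\mathbf{u}^i\|^2,\quad i=1,\dots,M.$$ Choose $\mathbf{u}_0^i\in\mathbf{U}^i$ for all $i$; for $k\ge0$ set $$\mathbf{u}_{k+1}^i=\frac1M\bar{\mathbf v}^i(\mathbf{u}_k)+\frac{M-1}{M}\mathbf{u}_k^i,\quad i=1,\dots,M.$$ *)

(* Defs.v *)
From HB Require Import structures.
From mathcomp Require Import all_boot all_order all_algebra.
From mathcomp Require Import all_classical all_reals all_analysis.
Import Order.TTheory GRing.Theory Num.Theory.
Import numFieldNormedType.Exports.

Set Implicit Arguments.
Unset Strict Implicit.
Unset Printing Implicit Defensive.

Local Open Scope classical_set_scope.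
Local Open Scope ring_scope.

Definition is_argmin (R : realType) (T : Type) (A : set T) (g : T -> R) (x : T)
  : Prop := A x /\ forall y, A y -> g x <= g y.

Definition dotp (R : realType) (m : nat) (x y : 'cV[R]_m) : R :=
  \sum_(j < m) x j 0 * y j 0.

(* The canonical norm on 'cV[R]_m is the sup norm; the Euclidean one is needed
   here.  Both induce the same topology, hence the same notions of closed set
   and of differentiability. *)
Definition enorm (R : realType) (m : nat) (x : 'cV[R]_m) : R :=
  Num.sqrt (dotp x x).

(* This is the gradient only at points where f is differentiable. *)
Definition grad (R : realType) (m : nat) (f : 'cV[R]_m -> R) (u : 'cV[R]_m)
  : 'cV[R]_m := \col_(j < m) 'D_(delta_mx j 0) f u.

(* Block vectors live in dimension \sum_i n i, and the i-th block of u is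
   submxcol u i. *)
Definition blockE (R : realType) (M : nat) (n : 'I_M -> nat) (i : 'I_M)
  : 'M[R]_(\sum_j n j, n i) := submxrow 1%:M i.

Definition pgrad (R : realType) (M : nat) (n : 'I_M -> nat)
    (f : 'cV[R]_(\sum_j n j) -> R) (i : 'I_M) (u : 'cV[R]_(\sum_j n j))
  : 'cV[R]_(n i) := (blockE R n i)^T *m grad f u.

Definition coord_lipschitz_grad (R : realType) (M : nat) (n : 'I_M -> nat)
    (L : 'I_M -> R) (f : 'cV[R]_(\sum_j n j) -> R) : Prop :=
  forall (u : 'cV[R]_(\sum_j n j)) (i : 'I_M) (h : 'cV[R]_(n i)),
    enorm (pgrad f i (u + blockE R n i *m h) - pgrad f i u) <= L i * enorm h.

Definition norm1 (R : realType) (M : nat) (n : 'I_M -> nat) (L : 'I_M -> R)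
    (u : 'cV[R]_(\sum_j n j)) : R :=
  Num.sqrt (\sum_(i < M) L i * enorm (submxcol u i) ^+ 2).

Definition prodset (R : realType) (M : nat) (n : 'I_M -> nat)
    (U : forall i : 'I_M, set 'cV[R]_(n i)) : set 'cV[R]_(\sum_j n j) :=
  [set u | forall i : 'I_M, U i (submxcol u i)].

Definition pcdm_model (R : realType) (M : nat) (n : 'I_M -> nat)
    (L : 'I_M -> R) (f : 'cV[R]_(\sum_j n j) -> R)
    (u : 'cV[R]_(\sum_j n j)) (i : 'I_M) (v : 'cV[R]_(n i)) : R :=
  dotp (pgrad f i u) (v - submxcol u i)
  + L i / 2 * enorm (v - submxcol u i) ^+ 2.

(* vbar is a block minimizer, which exists and is unique when L i > 0 and U i
   is nonempty, closed and convex, by strong convexity of the model. *)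
Definition pcdm_seq (R : realType) (M : nat) (n : 'I_M -> nat)
    (L : 'I_M -> R) (U : forall i : 'I_M, set 'cV[R]_(n i))
    (f : 'cV[R]_(\sum_j n j) -> R) (u : nat -> 'cV[R]_(\sum_j n j)) : Prop :=
  prodset U (u 0%N) /\
  forall (k : nat) (i : 'I_M), exists vbar : 'cV[R]_(n i),
    is_argmin (U i) (@pcdm_model R M n L f (u k) i) vbar /\
    submxcol (u k.+1) i
      = M%:R^-1 *: vbar + ((M%:R - 1) / M%:R) *: submxcol (u k) i.

(* Main.v *)
Require Import Defs.
From HB Require Import structures.
From mathcomp Require Import all_boot all_order all_algebra.
From mathcomp Require Import all_classical all_reals all_analysis.
From mathcomp Require Import ring lra.
Import Order.TTheory GRing.Theory Num.Theory.
Import numFieldNormedType.Exports.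

(** The proof is a Lyapunov argument.  Write [delta k] for the gap
    [f (u k) - f ustar] and [r k] for half the squared weighted distance
    [norm1 L (u k - ustar) ^+ 2 / 2].

    The key is the one-step inequality
    [delta (k+1) + r (k+1) <= (1 - 1/M) delta k + r k].
    The new iterate is the average of [M] points, each of which differs from
    [u k] in one block only; coordinatewise smoothness bounds [f] at each of
    these by the model of its block, and convexity carries the bound over to the
    average, so that [f] changes by at most [1/M] times the sum of the minimal
    values of the block models ([pcdm_step_model_decrease]).  The models are
    strongly convex, so their minimal values lie below their values at [ustar]
    by at least [L i / 2] times the squared distance between the minimizer and
    [ustar] ([argmin_quadratic_growth]).  Since the squared distance is convex,
    [1/M] times this extra term covers the change of [r]
    ([pcdm_step_lyapunov]).

    The gap is moreover nonincreasing, because each model is zero at [u k]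
    itself.  Hence [(1 + k/M) delta k + r k] is nonincreasing in [k]
    ([weighted_lyapunov_bound]); comparing it with its initial value and
    dropping [r k >= 0] gives the rate [M / (M + k)]. *)

Set Implicit Arguments.
Unset Strict Implicit.
Unset Printing Implicit Defensive.

Local Open Scope classical_set_scope.
Local Open Scope ring_scope.

(** * The Euclidean inner product *)

Lemma dotpC (R : realType) (m : nat) (x y : 'cV[R]_m) : dotp x y = dotp y x.
Proof. by apply: eq_bigr => j _; rewrite mulrC. Qed.

Lemma dotpDl (R : realType) (m : nat) (x y z : 'cV[R]_m) :
  dotp (x + y) z = dotp x z + dotp y z.
Proof.
by rewrite /dotp -big_split; apply: eq_bigr => j _; rewrite !mxE mulrDl.
Qed.

Lemma dotpZl (R : realType) (m : nat) (a : R) (x y : 'cV[R]_m) :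
  dotp (a *: x) y = a * dotp x y.
Proof.
by rewrite /dotp mulr_sumr; apply: eq_bigr => j _; rewrite !mxE mulrA.
Qed.

Lemma dotpNl (R : realType) (m : nat) (x y : 'cV[R]_m) :
  dotp (- x) y = - dotp x y.
Proof. by rewrite -scaleN1r dotpZl mulN1r. Qed.

Lemma dotpDr (R : realType) (m : nat) (x y z : 'cV[R]_m) :
  dotp x (y + z) = dotp x y + dotp x z.
Proof. by rewrite dotpC dotpDl !(dotpC _ x). Qed.

Lemma dotpZr (R : realType) (m : nat) (a : R) (x y : 'cV[R]_m) :
  dotp x (a *: y) = a * dotp x y.
Proof. by rewrite dotpC dotpZl dotpC. Qed.

Lemma dotpNr (R : realType) (m : nat) (x y : 'cV[R]_m) :
  dotp x (- y) = - dotp x y.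
Proof. by rewrite dotpC dotpNl dotpC. Qed.

Lemma dotp0r (R : realType) (m : nat) (x : 'cV[R]_m) : dotp x 0 = 0.
Proof. by apply: big1 => j _; rewrite mxE mulr0. Qed.

Definition dotpE := (dotpDl, dotpDr, dotpNl, dotpNr, dotpZl, dotpZr).

Lemma dotp_subC (R : realType) (m : nat) (x y : 'cV[R]_m) :
  dotp (x - y) (x - y) = dotp (y - x) (y - x).
Proof. by rewrite -opprB dotpNl dotpNr opprK. Qed.

Lemma dotp_sumr (R : realType) (m : nat) (I : finType) (x : 'cV[R]_m)
    (y : I -> 'cV[R]_m) :
  dotp x (\sum_i y i) = \sum_i dotp x (y i).
Proof.
rewrite /dotp exchange_big; apply: eq_bigr => j _.
by rewrite summxE mulr_sumr.
Qed.

Lemma dotp_mulmx (R : realType) (m p : nat) (A : 'M[R]_(m, p))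
    (x : 'cV[R]_m) (y : 'cV[R]_p) :
  dotp x (A *m y) = dotp (A^T *m x) y.
Proof.
have dotE q (a b : 'cV[R]_q) : dotp a b = (a^T *m b) 0 0.
  by rewrite mxE; apply: eq_bigr => j _; rewrite mxE.
by rewrite !dotE trmx_mul trmxK mulmxA.
Qed.

Lemma dotp_ge0 (R : realType) (m : nat) (x : 'cV[R]_m) : 0 <= dotp x x.
Proof. by apply: sumr_ge0 => j _; rewrite -expr2 sqr_ge0. Qed.

Lemma enorm_sqr (R : realType) (m : nat) (x : 'cV[R]_m) :
  enorm x ^+ 2 = dotp x x.
Proof. by rewrite sqr_sqrtr ?dotp_ge0. Qed.

(** Cauchy-Schwarz would give this at once; expanding the square
    [0 <= |g - c h|^2] and bounding [|g|] by [c |h|] gives it directly, without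
    a special case for [h = 0]. *)
Lemma dotp_le_of_enorm (R : realType) (m : nat) (c : R) (g h : 'cV[R]_m) :
  0 < c -> enorm g <= c * enorm h -> dotp g h <= c * dotp h h.
Proof.
move=> c0 gh.
have gg : dotp g g <= c ^+ 2 * dotp h h.
  by rewrite -!enorm_sqr -exprMn ler_sqr ?nnegrE ?mulr_ge0 ?sqrtr_ge0 // ltW.
have := dotp_ge0 (g - c *: h); rewrite !dotpE (dotpC h g) => sq.
by rewrite -(ler_pM2l c0); nra.
Qed.

(** Convexity of the squared Euclidean distance to [w]; the gap is
    [a b |v - u|^2]. *)
Lemma dotp_convex (R : realType) (m : nat) (a b : R) (v u w : 'cV[R]_m) :
  0 <= a -> 0 <= b -> a + b = 1 ->
  dotp (a *: v + b *: u - w) (a *: v + b *: u - w)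
  <= a * dotp (v - w) (v - w) + b * dotp (u - w) (u - w).
Proof.
move=> a0 b0 ab1; have be : b = 1 - a by rewrite -ab1 addrAC subrr add0r.
have h : 0 <= a * b * dotp (v - u) (v - u) by rewrite !mulr_ge0 ?dotp_ge0.
rewrite -subr_ge0; move: h; rewrite be !dotpE.
rewrite (dotpC u v) (dotpC w v) (dotpC w u); lra.
Qed.

(** * First-order inequalities for convex and for smooth functions *)

Lemma derive_dotp_grad (R : realType) (m : nat) (f : 'cV[R]_m -> R)
    (u v : 'cV[R]_m) :
  differentiable f u -> 'D_v f u = dotp (grad f u) v.
Proof.
move=> df; rewrite deriveE // {1}[v]matrix_sum_delta.
rewrite exchange_big big_ord1 linear_sum; apply: eq_bigr => j _.
by rewrite linearZ /= mxE deriveE // mulrC.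
Qed.

Lemma is_derive_line (R : realType) (m : nat) (f : 'cV[R]_m -> R)
    (u v : 'cV[R]_m) (t : R) :
  differentiable f (u + t *: v) ->
  is_derive t 1 (fun s : R => f (u + s *: v)) (dotp (grad f (u + t *: v)) v).
Proof.
move=> df.
have E : (fun h : R => h^-1 *: (f (u + (h *: 1 + t) *: v) - f (u + t *: v)))
       = (fun h : R => h^-1 *: (f (h *: v + (u + t *: v)) - f (u + t *: v))).
  by apply/funext => h; rewrite scalerDl [h *: 1]mulr1 addrCA.
split; first by have := diff_derivable (v:=v) df; rewrite /derivable E.
by rewrite -derive_dotp_grad // /derive E.
Qed.

(** The difference quotients of a convex function along [w - u] lie below
    [f w - f u] on [`]0, 1]], and so does their limit at 0. *)
Lemma convex_grad_le (R : realType) (m : nat) (f : 'cV[R]_m -> R)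
    (u w : 'cV[R]_m) :
  convex_function setT f -> differentiable f u ->
  f u + dotp (grad f u) (w - u) <= f w.
Proof.
move=> cf df; rewrite -lerBrDl -derive_dotp_grad //.
have cD : h^-1 *: (f (h *: (w - u) + u) - f u) @[h --> 0^'+]
    --> 'D_(w - u) f u.
  by apply: cvg_dnbhs_at_right; exact: (diff_derivable (v:=w - u) df).
apply: (cvgr_to_le cD); near=> t.
have t0 : 0 < t by near: t; exact: nbhs_right_gt.
have t1 : t <= 1 by near: t; exact: nbhs_right_le.
have := cf (Itv01 (ltW t0) t1) w u (in_setT _) (in_setT _).
have -> : conv (Itv01 (ltW t0) t1) (w : convex_lmodType _) u
    = t *: (w - u) + u.
  by rewrite /conv /= scalerBr scalerBl scale1r addrAC addrA addrAC.
rewrite convRE /= /unstable.onem => le.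
rewrite -[_ *: _]/(_ * _) mulrC ler_pdivrMr //.
lra.
Unshelve. all: by end_near. Qed.

(** The number [q] stands for [|h|^2].  Along the segment the derivative of [f]
    exceeds its initial value by at most [c t q], so subtracting [c t^2 / 2 q]
    from [f (u + t h)] minus its tangent leaves a nonincreasing function of
    [t]. *)
Lemma descent_of_grad_lipschitz (R : realType) (m : nat) (f : 'cV[R]_m -> R)
    (c : R) (u h : 'cV[R]_m) (q : R) :
  (forall x, differentiable f x) ->
  (forall t, 0 < t ->
     dotp (grad f (u + t *: h)) h - dotp (grad f u) h <= c * t * q) ->
  f (u + h) <= f u + dotp (grad f u) h + c / 2 * q.
Proof.
move=> df dle.
pose phi (t : R) := f (u + t *: h) - t * dotp (grad f u) h
  - t ^+ 2 * (c / 2 * q).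
have dphi (t : R) : is_derive t 1 phi
    (dotp (grad f (u + t *: h)) h - dotp (grad f u) h - c * t * q).
  have d1 := is_derive_line (df (u + t *: h)).
  rewrite /phi; apply: is_derive_eq.
  move: (dotp _ h) (dotp _ h) {d1} => a b.
  by rewrite /GRing.scale /=; field.
have cphi : {within `[0, 1], continuous phi}.
  apply: continuous_subspaceT => t.
  by apply: differentiable_continuous; apply/derivable1_diffP; case: (dphi t).
have [t /andP[t0 _] e] := MVT (@ltr01 R) (fun t _ => dphi t) cphi.
rewrite bnd_simp in t0.
move: (dle t t0) e; rewrite /phi scale1r scale0r addr0; nra.
Qed.

(** * Minimizing a quadratic over a convex set *)

Lemma convex_set_segment (R : realType) (m : nat) (C : set 'cV[R]_m)
    (a b : R) (x y : 'cV[R]_m) :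
  convex_set C -> 0 <= a -> 0 <= b -> a + b = 1 -> C x -> C y ->
  C (a *: x + b *: y).
Proof.
move=> cC a0 b0 ab1 Cx Cy.
have a1 : a <= 1 by rewrite -ab1 lerDl.
have := cC x y (Itv01 a0 a1); rewrite !inE => /(_ Cx Cy).
by rewrite /conv /= /unstable.onem -ab1 addrAC subrr add0r.
Qed.

(** The quadratic has modulus of strong convexity [c], so its growth away from
    the minimizer [v] is at least [c / 2 |w - v|^2].  The excess is the slope
    at [v] in the direction of [w], which cannot be negative. *)
Lemma argmin_quadratic_growth (R : realType) (m : nat) (C : set 'cV[R]_m)
    (c : R) (g a v w : 'cV[R]_m) :
  let q y := dotp g (y - a) + c / 2 * enorm (y - a) ^+ 2 in
  0 <= c -> convex_set C -> is_argmin C q v -> C w ->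
  q v + c / 2 * dotp (w - v) (w - v) <= q w.
Proof.
move=> q c0 cC [Cv vmin] Cw.
pose A := dotp (g + c *: (v - a)) (w - v); pose B := dotp (w - v) (w - v).
have qE t : q (t *: w + (1 - t) *: v) = q v + t * A + c / 2 * t ^+ 2 * B.
  rewrite /q !enorm_sqr.
  have -> : t *: w + (1 - t) *: v - a = (v - a) + t *: (w - v).
    by rewrite scalerBl scale1r scalerBr addrCA addrAC.
  rewrite /A /B; move: (w - v) (v - a) => d e.
  by rewrite !dotpE (dotpC d e); field.
have B0 : 0 <= B by exact: dotp_ge0.
have A0 : 0 <= A.
  rewrite leNgt; apply/negP => An.
  have cB0 : 0 <= c * B by exact: mulr_ge0.
  have s0 : 0 < c * B - A by lra.
  (* Were the slope [A] negative, the quadratic term [c / 2 t^2 B] would be at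
     most [- t A / 2] for this [t], and the value would drop below [q v]. *)
  pose t := - A / (c * B - A).
  have ts : t * (c * B - A) = - A by rewrite divfK // gt_eqF.
  have t0 : 0 < t by rewrite divr_gt0 // oppr_gt0.
  have t1 : t <= 1 by rewrite ler_pdivrMr // mul1r; lra.
  have Ct : C (t *: w + (1 - t) *: v) by apply: convex_set_segment => //; lra.
  by have := vmin _ Ct; rewrite qE -/B; nra.
have := qE 1; rewrite scale1r subrr scale0r addr0 => ->.
by rewrite -/B; lra.
Qed.

(** * One step of the parallel coordinate descent method *)

Section PCDM.
Variables (R : realType) (M : nat) (n : 'I_M -> nat).
Variables (L : 'I_M -> R) (f : 'cV[R]_(\sum_j n j) -> R).
Hypothesis hL : forall i, 0 < L i.
Hypothesis df : forall u, differentiable f u.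
Implicit Types (u w v : 'cV[R]_(\sum_j n j)).

Lemma sum_blockE u : \sum_i blockE R n i *m submxcol u i = u.
Proof.
by rewrite -mul_mxrow_mxcol submxrowK submxcolK mul1mx.
Qed.

Lemma dotp_grad_block u i (h : 'cV[R]_(n i)) :
  dotp (grad f u) (blockE R n i *m h) = dotp (pgrad f i u) h.
Proof. exact: dotp_mulmx. Qed.

Lemma dotp_grad_blocks u w :
  dotp (grad f u) w = \sum_i dotp (pgrad f i u) (submxcol w i).
Proof.
rewrite -{1}[w]sum_blockE dotp_sumr.
by apply: eq_bigr => i _; exact: dotp_grad_block.
Qed.

(** Moving along one block only, the Lipschitz constant of that block alone
    controls the change of slope. *)
Lemma block_descent (hlip : coord_lipschitz_grad L f) u i (h : 'cV[R]_(n i)) :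
  f (u + blockE R n i *m h)
  <= f u + dotp (pgrad f i u) h + L i / 2 * dotp h h.
Proof.
rewrite -dotp_grad_block; apply: descent_of_grad_lipschitz => // t t0.
rewrite !dotp_grad_block -dotpNl -dotpDl.
apply: dotp_le_of_enorm; first exact: mulr_gt0.
have := hlip u i (t *: h); rewrite -scalemxAr -mulrA; congr (_ <= L i * _).
by rewrite /enorm dotpZl dotpZr mulrA -expr2 sqrtrM ?sqr_ge0 // sqrtr_sqr gtr0_norm.
Qed.

Lemma norm1_sqr u :
  norm1 L u ^+ 2 = \sum_i L i * dotp (submxcol u i) (submxcol u i).
Proof.
rewrite sqr_sqrtr; first by under eq_bigr do rewrite enorm_sqr.
by apply: sumr_ge0 => i _; rewrite mulr_ge0 ?sqr_ge0 // ltW.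
Qed.

Section step.
Variables (hM : (1 <= M)%N) (U : forall i : 'I_M, set 'cV[R]_(n i)).
Arguments U : clear implicits.
Hypothesis hU : forall i : 'I_M, convex_set (U i).
Hypothesis cf : convex_function setT f.
Hypothesis hlip : coord_lipschitz_grad L f.
Variables (u u' : 'cV[R]_(\sum_j n j)) (v : forall i, 'cV[R]_(n i)).
Hypothesis hu : prodset U u.
Hypothesis hv : forall i, is_argmin (U i) (@pcdm_model R M n L f u i) (v i).
Hypothesis hu' : forall i, submxcol u' i
  = M%:R^-1 *: v i + ((M%:R - 1) / M%:R) *: submxcol u i.

Let M_gt0 : 0 < M%:R :> R. Proof. by rewrite ltr0n. Qed.

Let invM_ge0 : 0 <= M%:R^-1 :> R. Proof. by rewrite invr_ge0 ltW. Qed.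

Let weight_ge0 : 0 <= (M%:R - 1) / M%:R :> R.
Proof. by rewrite divr_ge0 // subr_ge0 ler1n. Qed.

Let weightE : M%:R^-1 + (M%:R - 1) / M%:R = 1 :> R.
Proof. by field; rewrite gt_eqF. Qed.

Lemma pcdm_step_feasible : prodset U u'.
Proof.
move=> i; rewrite hu'; apply: convex_set_segment => //.
by have [] := hv i.
Qed.

(** The new iterate is the average of the [M] points obtained from [u] by
    moving a single block, and each of these obeys the block descent
    inequality.  Jensen's inequality for this average is obtained by summing the
    tangent inequalities at [u'], where the first-order terms cancel. *)
Lemma pcdm_step_model_decrease :
  f u' <= f u + M%:R^-1 * \sum_i @pcdm_model R M n L f u i (v i).
Proof.
pose d i := v i - submxcol u i.
have u'E : u' = u + M%:R^-1 *: \sum_i blockE R n i *m d i.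
  rewrite -[LHS]sum_blockE -{1}[u]sum_blockE scaler_sumr -big_split /=.
  apply: eq_bigr => i _; rewrite hu' scalemxAr -mulmxDr; congr (_ *m _).
  rewrite scalerBr [X in _ = X + _](_ : _ = M%:R^-1 *: submxcol u i
      + ((M%:R - 1) / M%:R) *: submxcol u i).
    by rewrite [RHS]addrC addrA subrK.
  by rewrite -scalerDl weightE scale1r.
have gap : \sum_i (u + blockE R n i *m d i - u') = 0.
  rewrite sumrB big_split /= !sumr_const card_ord u'E mulrnDl.
  by rewrite -(scaler_nat M (_ *: _)) scalerA divff ?gt_eqF // scale1r subrr.
have block i : f u' + dotp (grad f u') (u + blockE R n i *m d i - u')
    <= f u + @pcdm_model R M n L f u i (v i).
  apply: le_trans (convex_grad_le _ cf (df u')) _.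
  by rewrite /pcdm_model enorm_sqr addrA; exact: block_descent.
have := ler_sum (index_enum _) (fun i (_ : true) => block i).
rewrite !big_split /= -dotp_sumr gap !sumr_const card_ord.
rewrite dotp0r addr0 -(mulr_natl (f u')) -(mulr_natl (f u)) => le.
by rewrite -(ler_pM2l M_gt0) mulrDr mulrA divff ?gt_eqF // mul1r.
Qed.

(** In each block the gain [L i / 2 |w - v|^2] of the minimizer over [w] in the
    model pays, through convexity of the squared distance, for the decrease of
    the distance to [w]; both carry the factor [1 / M].  What is left of the
    model at [w] is linear, and the tangent inequality bounds it by
    [f w - f u]. *)
Lemma pcdm_step_lyapunov w : prodset U w ->
  f u' + 1 / 2 * norm1 L (u' - w) ^+ 2
  <= f u + M%:R^-1 * (f w - f u) + 1 / 2 * norm1 L (u - w) ^+ 2.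
Proof.
move=> hw; rewrite !norm1_sqr.
have grad_le := convex_grad_le w cf (df u).
have block i : M%:R^-1 * @pcdm_model R M n L f u i (v i)
    + L i / 2 * dotp (submxcol (u' - w) i) (submxcol (u' - w) i)
    <= M%:R^-1 * dotp (pgrad f i u) (submxcol (w - u) i)
    + L i / 2 * dotp (submxcol (u - w) i) (submxcol (u - w) i).
  set mv := pcdm_model L f u (v i).
  have growth : mv + L i / 2 * dotp (v i - submxcol w i) (v i - submxcol w i)
      <= dotp (pgrad f i u) (submxcol w i - submxcol u i)
         + L i / 2 * dotp (submxcol u i - submxcol w i)
                          (submxcol u i - submxcol w i).
    rewrite (dotp_subC (v i)) (dotp_subC (submxcol u i)).
    rewrite -(enorm_sqr (submxcol w i - submxcol u i)).
    exact: argmin_quadratic_growth (ltW (hL i)) (hU (i:=i)) (hv i) (hw i).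
  have relax := dotp_convex (v i) (submxcol u i) (submxcol w i)
    invM_ge0 weight_ge0 weightE.
  rewrite !submxcolB hu'.
  have L0 : 0 <= L i / 2 by rewrite divr_ge0 // ltW.
  have := ler_wpM2l invM_ge0 growth; have := ler_wpM2l L0 relax.
  rewrite (_ : (M%:R - 1) / M%:R = 1 - M%:R^-1); last first.
    by field; rewrite gt_eqF.
  move: (M%:R^-1 : R) => p; lra.
have := ler_sum (index_enum _) (fun i (_ : true) => block i).
rewrite !big_split /= -!mulr_sumr -dotp_grad_blocks.
have half (F : 'I_M -> R) : \sum_i L i / 2 * F i = 1 / 2 * \sum_i L i * F i.
  by rewrite mulr_sumr; apply: eq_bigr => i _; field.
rewrite !half => sum_le.
have decrease := pcdm_step_model_decrease.
have grad_gap : M%:R^-1 * dotp (grad f u) (w - u) <= M%:R^-1 * (f w - f u).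
  by rewrite ler_pM2l ?invr_gt0 //; lra.
lra.
Qed.

(** The model vanishes at [u] itself, so its minimum is nonpositive. *)
Lemma pcdm_step_nonincreasing : f u' <= f u.
Proof.
apply: le_trans pcdm_step_model_decrease _.
rewrite gerDl pmulr_rle0 ?invr_gt0 //.
apply: sumr_le0 => i _; have [_ /(_ _ (hu i))] := hv i.
by rewrite {2}/pcdm_model subrr enorm_sqr !dotp0r mulr0 addr0.
Qed.

End step.
End PCDM.

(** * From one step to the rate *)

(** Weighting the gap of the [k]-th iterate by [1 + k / M], the decrease of the
    Lyapunov function exactly pays for the growth of the weight. *)
Lemma weighted_lyapunov_bound (R : realFieldType) (m : R) (delta r : nat -> R) :
  0 < m ->
  (forall k, delta k.+1 <= delta k) ->
  (forall k, delta k.+1 + r k.+1 <= (1 - m^-1) * delta k + r k) ->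
  forall k, (1 + k%:R / m) * delta k + r k <= delta 0 + r 0.
Proof.
move=> m0 mono lyap; elim=> [|k IH]; first by rewrite mul0r addr0 mul1r.
apply: le_trans IH.
have e : k.+1%:R / m * delta k.+1 <= k.+1%:R / m * delta k.
  by rewrite ler_wpM2l // divr_ge0 // ltW.
move: (lyap k) e; rewrite -natr1 mulrDl mul1r; lra.
Qed.

Theorem theorem1 (R : realType) (M : nat) (n : 'I_M -> nat)
    (hM : (1 <= M)%N) (hn : forall i : 'I_M, (0 < n i)%N)
    (L : 'I_M -> R) (hL : forall i : 'I_M, 0 < L i)
    (U : forall i : 'I_M, set 'cV[R]_(n i))
    (hU0 : forall i : 'I_M, U i !=set0)
    (hUclosed : forall i : 'I_M, closed (U i))
    (hUconvex : forall i : 'I_M, convex_set (U i))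
    (f : 'cV[R]_(\sum_j n j) -> R)
    (hfconvex : convex_function setT f)
    (hfdiff : forall u : 'cV[R]_(\sum_j n j), differentiable f u)
    (hflip : coord_lipschitz_grad L f)
    (ustar : 'cV[R]_(\sum_j n j))
    (hustar : is_argmin (prodset U) f ustar)
    (u : nat -> 'cV[R]_(\sum_j n j))
    (hu : pcdm_seq L U f u) :
  let fstar : R := inf (f @` prodset U) in
  let r0 : R := norm1 L (u 0%N - ustar) in
  forall k : nat,
    f (u k) - fstar
      <= M%:R / (M%:R + k%:R) * (1 / 2 * r0 ^+ 2 + f (u 0%N) - fstar).
Proof.
move=> fstar r0.
have M0 : 0 < M%:R :> R by rewrite ltr0n.
have fstarE : fstar = f ustar.
  have [hs hmin] := hustar.
  apply/eqP; rewrite eq_le; apply/andP; split.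
    by apply: ge_inf; [exists (f ustar) => _ [x hx <-]; exact: hmin|exists ustar].
  by apply: lb_le_inf; [exists (f ustar), ustar|move=> _ [x hx <-]; exact: hmin].
have [h0 hstep] := hu.
have hv k i := proj1 (svalP (cid (hstep k i))).
have hu' k i := proj2 (svalP (cid (hstep k i))).
have feas k : prodset U (u k).
  elim: k => [//|k IH].
  exact: (pcdm_step_feasible hM hUconvex IH (hv k) (hu' k)).
have [hs _] := hustar.
pose r k := 1 / 2 * norm1 L (u k - ustar) ^+ 2.
have mono k : f (u k.+1) - fstar <= f (u k) - fstar.
  apply: lerB => //.
  exact: (pcdm_step_nonincreasing hL hfdiff hM hfconvex hflip
    (feas k) (hv k) (hu' k)).
have lyap k : f (u k.+1) - fstar + r k.+1
    <= (1 - M%:R^-1) * (f (u k) - fstar) + r k.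
  rewrite fstarE /r.
  have := pcdm_step_lyapunov hL hfdiff hM hUconvex hfconvex hflip
    (hv k) (hu' k) hs.
  lra.
have bound k : (1 + k%:R / M%:R) * (f (u k) - fstar)
    <= 1 / 2 * r0 ^+ 2 + f (u 0%N) - fstar.
  have rk0 : 0 <= r k by rewrite mulr_ge0 ?sqr_ge0 // divr_ge0.
  have r0E : r 0%N = 1 / 2 * r0 ^+ 2 by [].
  have := weighted_lyapunov_bound M0 mono lyap k.
  rewrite r0E; lra.
move=> k; have Mk0 : 0 < M%:R + k%:R :> R by rewrite ltr_wpDr.
have -> : M%:R / (M%:R + k%:R) = (1 + k%:R / M%:R)^-1 :> R.
  by field; rewrite !gt_eqF.
rewrite ler_pdivlMl // ltr_pwDl // divr_ge0 // ltW.
Qed.
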